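(* Let $\alpha=[a_1,a_2,\dots]\in(0,1)$ be irrational and $\beta\in[0,1)$. For any interval $I\subset[0,1]$, written $I=[\gamma,\delta]$, with length $|I|$, it holds $$\sum_{k=0}^{n-1}\chi_I(\{k\alpha+\beta\})-n|I|=d_n(\alpha,\{\delta-\beta\})-d_n(\alpha,\{\gamma-\beta\}),$$ from which it follows that $$\Big|\sum_{k=0}^{n-1}\chi_I(\{k\alpha+\beta\})-n|I|\Big|\le 2\sum_{m=1}^{N}\Big(3+\frac{a_m}{4}\Big),$$ where $N=\mathrm{ord}(n-1)$.
   Context: $[a_1,a_2,\dots]=1/(a_1+1/(a_2+\cdots))$ with positive integers $a_h$; $q_n$ is the denominator of the convergent $[a_1,\dots,a_n]$ of $\alpha$: $q_0=1$, $q_1=a_1$, $q_{n+1}=a_{n+1}q_n+q_{n-1}$. $\{\cdot\}$ is the fractional part and $\chi_A$ is the indicator function of $A$. The relative discrepancy is $d_n(\alpha,x):=\sum_{r=0}^{n-1}\chi_{[0,x)}(\{r\alpha\})-xn$. Order of an integer: every positive integer $r$ can be written uniquely as $r=\sum_{h=0}^{N}c_hq_h$ (Ostrowski representation) with integers $0\le c_h\le a_{h+1}$, $c_0\le a_1-1$, $c_{h-1}=0$ whenever $c_h=a_{h+1}$, and $c_N>0$; then $\mathrm{ord}(r):=N$.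
   Formalization: The sum in the bound runs to N+1, not N (the printed bound fails for α=√2−1, β=0, n=2, I=[0,1/4]), and n≥2 so that ord(n−1) is defined; for closed I the identity assumes {kα+β}≠δ for all k<n (it fails when δ is hit, e.g. γ=δ=β, n=1). *)

(* Defs.v *)
From mathcomp Require Import all_boot all_order all_algebra.
From mathcomp Require Import all_classical all_reals all_analysis.

Set Implicit Arguments.
Unset Strict Implicit.
Unset Printing Implicit Defensive.

Import Order.TTheory GRing.Theory Num.Theory.
Import numFieldNormedType.Exports.

Local Open Scope classical_set_scope.
Local Open Scope ring_scope.

(* Partial quotients are [a 1, a 2, ...]; the value [a 0] is never used. *)

(* [cfrac a h n] is the finite continued fraction
   [a_h, ..., a_(h+n-1)] = 1/(a_h + 1/(... + 1/a_(h+n-1))). *)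
Fixpoint cfrac (R : realType) (a : nat -> nat) (h n : nat) : R :=
  if n is n'.+1 then ((a h)%:R + cfrac R a h.+1 n')^-1 else 0.

Definition is_cfrac (R : realType) (a : nat -> nat) (alpha : R) : Prop :=
  (forall h, (0 < h)%N -> (0 < a h)%N) /\
  cfrac R a 1 n @[n --> \oo] --> alpha.

Fixpoint cf_denom (a : nat -> nat) (n : nat) : nat :=
  match n with
  | 0 => 1
  | n1.+1 => match n1 with
             | 0 => a 1
             | n2.+1 => a n * cf_denom a n1 + cf_denom a n2
             end
  end%N.

Definition is_ostrowski (a : nat -> nat) (r N : nat) (c : nat -> nat) : Prop :=
  [/\ r = (\sum_(0 <= h < N.+1) c h * cf_denom a h)%N,
      forall h, (h <= N)%N -> (c h <= a h.+1)%N,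
      (c 0 <= a 1 - 1)%N,
      forall h, (0 < h <= N)%N -> c h = a h.+1 -> c h.-1 = 0%N
    & (0 < c N)%N].

(* Meaningful for [0 < r] only: 0 has no representation with [0 < c N]. *)
Definition ostrowski_ord (a : nat -> nat) (r : nat) : nat :=
  xget 0%N [set N | exists c, is_ostrowski a r N c].

Definition fracpart (R : realType) (x : R) : R := x - (Num.floor x)%:~R.

Definition discr (R : realType) (n : nat) (alpha x : R) : R :=
  \sum_(0 <= r < n) \1_(`[0, x[) (fracpart (r%:R * alpha)) - x * n%:R.

(* [Interval (BSide bl gamma) (BSide br delta)] is closed on the left iff
   [bl = true] and closed on the right iff [br = false]. *)
Definition itv_discr (R : realType) (n : nat) (alpha beta : R)
    (bl br : bool) (gamma delta : R) : R :=
  \sum_(0 <= k < n) \1_([set` Interval (BSide bl gamma) (BSide br delta)])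
                      (fracpart (k%:R * alpha + beta))
  - n%:R * (delta - gamma).

(* Main.v *)
Require Import Defs.
From mathcomp Require Import all_boot all_order all_algebra.
From mathcomp Require Import all_classical all_reals all_analysis.
From mathcomp Require Import ring lra zify.

Import Order.TTheory GRing.Theory Num.Theory.
Import numFieldNormedType.Exports.

Local Open Scope classical_set_scope.
Local Open Scope ring_scope.

(** The discrepancy of an interval is a difference of two sawtooth sums.
Write [psi y = {y} - 1/2] and [S(alpha, t, n)] for the sum of
[psi (k alpha + t)] over [k < n]. For [u] in [[0, 1[] and [d] in [[0, 1]],
[{u - d}] is [u - d], plus [1] exactly when [u < d]; hence
[psi (y - d) - psi (y - g)] equals the indicator of [[g, d[] at [{y}] minus
[d - g]. Summing over the orbit, the discrepancy of [[g, d[] along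
[k alpha + beta] is [S(alpha, beta - d, n) - S(alpha, beta - g, n)]. The case
[beta = g = 0] expresses [discr] in the same way, and the identity follows. An
interval of another type differs at its endpoints only, and since [alpha] is
irrational the orbit visits each endpoint at most once, so that the total error
is at most [2].

It remains to bound [S(alpha, t, n)], uniformly in [t]. The idea is Euclid's
algorithm. On [[0, 1[], [psi] is the difference over one rotation step of a
quadratic polynomial [b], namely [psi x = b (x + alpha) - b x]
([sawtooth_primitive]). The sum therefore telescopes, except that each time the
orbit crosses an integer the argument drops by [1]; if [z] is the fractional
part just after the crossing, the defect [b (z + 1) - b z] is exactly
[psi (z / alpha)]. The successive values of [z / alpha] are themselves an orbit
modulo 1, of the rotation by [- 1 / alpha], that is by minus the next complete
quotient. So [S(alpha, t, n)] reduces to a sum of about [n alpha] terms for the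
next complete quotient ([sawtooth_sum_renorm]), and the boundary terms cost at
most [1 + a_1 / 8] ([sawtooth_sum_step]).

Iterating [K] times leaves an empty sum as soon as [n x_1 ... x_K < 1], where
the [x_i] are the complete quotients ([sawtooth_sum_bound]). Since
[x_1 ... x_K (q_K + x_{K+1} q_{K-1}) = 1] ([prod_complete_quotients]), this holds
whenever [n <= q_K]; and [n - 1 < q_{N+1}] when [N] is the order of [n - 1]
([ostrowski_ord_lt]), so [K = N + 1] is enough. Both sawtooth sums together cost
at most twice the sum of the [1 + a_m / 8] for [1 <= m <= N + 1], and what is
left of [3 + a_m / 4] pays for the endpoints. *)

(** * Fractional parts and the sawtooth function *)

Definition sawtooth {R : realType} (x : R) : R := fracpart x - 1 / 2.

Definition sawtooth_sum {R : realType} (al t : R) (n : nat) : R :=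
  \sum_(0 <= k < n) sawtooth (k%:R * al + t).

Lemma fracpart_itv {R : realType} (x : R) : 0 <= fracpart x < 1.
Proof.
have /andP[] := floor_itv x; rewrite /fracpart intrD => h1 h2.
by apply/andP; split; lra.
Qed.

Lemma fracpart_unique {R : realType} (x : R) (m : int) :
  0 <= x - m%:~R < 1 -> fracpart x = x - m%:~R.
Proof.
move=> /andP[h1 h2]; rewrite /fracpart (@floor_def _ x m)// intrD.
by apply/andP; split; lra.
Qed.

Lemma fracpartD_int {R : realType} (x : R) (m : int) :
  fracpart (x + m%:~R) = fracpart x.
Proof.
have := fracpart_itv x; rewrite {1 2}/fracpart => h.
rewrite (@fracpart_unique _ _ (Num.floor x + m)) intrD; first by rewrite /fracpart; ring.
by move: h => /andP[h1 h2]; apply/andP; split; lra.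
Qed.

Lemma sawtoothD_int {R : realType} (x : R) (m : int) : sawtooth (x + m%:~R) = sawtooth x.
Proof. by rewrite /sawtooth fracpartD_int. Qed.

Lemma normr_sawtooth {R : realType} (x : R) : `|sawtooth x| <= 1 / 2.
Proof.
by have /andP[h1 h2] := fracpart_itv x; rewrite ler_norml /sawtooth; apply/andP; split; lra.
Qed.

(** * Renormalisation of sawtooth sums *)

(** The quadratic polynomial [b] vanishing at [0] with
[b (x + al) - b x = x - 1 / 2]: a discrete primitive of the sawtooth on
[[0, 1[] for the rotation by [al]. *)
Definition sawtooth_primitive {R : realType} (al x : R) : R := x * (x - 1 - al) / (2 * al).

(** One step of Euclid's algorithm. [w] counts the crossings of an integer. After the
crossing number [i] (from [0]) the orbit lies in [[0, al[] modulo 1, at a point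
congruent to [t - floor t - 1 - i] modulo [al]; divided by [al], this is the
orbit of the rotation by [- al^-1]. *)
Lemma sawtooth_sum_renorm {R : realType} {al : R} (t : R) (n : nat) : 0 < al < 1 ->
  exists w : nat,
    [/\ Num.floor (n%:R * al + t) = Num.floor t + w%:Z &
    sawtooth_sum al t n =
      sawtooth_primitive al (fracpart (n%:R * al + t)) - sawtooth_primitive al (fracpart t) +
      \sum_(0 <= i < w) sawtooth ((t - (Num.floor t)%:~R - 1 - i%:R) / al)].
Proof.
move=> /andP[al0 al1]; have aln0 : al != 0 by rewrite gt_eqF.
elim: n => [|n [w [IHf IHs]]].
  exists 0%N; split; first by rewrite mul0r add0r addr0.
  by rewrite /sawtooth_sum !big_geq// mul0r add0r; ring.
have /andP[x0 x1] := fracpart_itv (n%:R * al + t).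
set y := n%:R * al + t in IHf IHs x0 x1 *.
have yS : n.+1%:R * al + t = y + al by rewrite /y -natr1; ring.
have xE : fracpart y = y - (Num.floor y)%:~R by [].
rewrite yS /sawtooth_sum big_nat_recr//= -/(sawtooth_sum al t n) IHs -/y.
have [ltx|gex] := ltP (fracpart y + al) 1.
  exists w; have fE : Num.floor (y + al) = Num.floor y.
    by apply: floor_def; rewrite intrD; apply/andP; split; lra.
  split; first by rewrite fE.
  have -> : fracpart (y + al) = fracpart y + al by rewrite /fracpart fE; ring.
  by rewrite /sawtooth /sawtooth_primitive; field.
exists w.+1; have fE : Num.floor (y + al) = Num.floor y + 1.
  by apply: floor_def; rewrite !intrD; apply/andP; split; lra.
split; first by rewrite fE IHf; lia.
have -> : fracpart (y + al) = fracpart y + al - 1.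
  by rewrite /fracpart fE intrD; ring.
rewrite big_nat_recr//=.
have -> : sawtooth ((t - (Num.floor t)%:~R - 1 - w%:R) / al) =
          (fracpart y + al - 1) / al - 1 / 2.
  rewrite /sawtooth; congr (_ - _).
  (* The arguments differ by the integer n + 1, and the one on the right lies in
     [[0, 1[], since [fracpart y + al - 1] is less than [al]. *)
  have tE : (t - (Num.floor t)%:~R - 1 - w%:R) / al =
      (fracpart y + al - 1) / al - n.+1%:R.
    by rewrite xE IHf intrD /y -natr1; rewrite -[w%:~R]/(w%:R); field.
  rewrite tE (@fracpart_unique _ _ (- n.+1%:Z)); rewrite rmorphN/=.
    by rewrite -[n.+1%:~R]/(n.+1%:R); ring.
  rewrite -[n.+1%:~R]/(n.+1%:R) opprK subrK; apply/andP; split.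
    by apply: divr_ge0; lra.
  by rewrite ltr_pdivrMr//; lra.
by rewrite /sawtooth /sawtooth_primitive; field.
Qed.

(** The lower bound is the value [- (1 + al) ^ 2 / (8 al)] at the vertex
[(1 + al) / 2], weakened by [al <= 1]. *)
Lemma sawtooth_primitive_itv {R : realType} {al x : R} : 0 < al < 1 -> 0 <= x < 1 ->
  - (al^-1 / 8 + 3 / 8) <= sawtooth_primitive al x <= 0.
Proof.
move=> /andP[al0 al1] /andP[x0 x1].
have -> : sawtooth_primitive al x = (x * (x - 1 - al) / 2) / al.
  by rewrite /sawtooth_primitive; field; rewrite gt_eqF.
apply/andP; split; last by rewrite ler_pdivrMr// mul0r; nra.
rewrite ler_pdivlMr//.
have -> : - (al^-1 / 8 + 3 / 8) * al = - (1 / 8 + 3 / 8 * al).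
  by field; rewrite gt_eqF.
(* Over the common denominator [8 al], the parabola exceeds its vertex value by
   the square of [2 x - 1 - al]. *)
have := sqr_ge0 (2 * x - 1 - al); nra.
Qed.

(** Modulo 1, the rotation by [- al^-1] is the rotation by [- al'], and traversed
backwards it is the rotation by [al']. The last crossing is estimated trivially,
at the cost of [1 / 2], so that the number of terms that remain is at most
[n * al] without rounding; this makes the bound on the number of terms pass
through the iteration as a plain product. *)
Lemma sawtooth_sum_step {R : realType} {al al' : R} {a : nat} (t : R) (n : nat) :
  0 < al < 1 -> 0 < al' < 1 -> al^-1 = a%:R + al' ->
  exists t' (m : nat), m%:R <= n%:R * al /\
    `|sawtooth_sum al t n| <= `|sawtooth_sum al' t' m| + (1 + a%:R / 8).
Proof.
move=> al01 /andP[al'0 al'1] alV.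
have [w [fE ->]] := sawtooth_sum_renorm t n al01.
have /andP[b1 b2] := sawtooth_primitive_itv al01 (fracpart_itv (n%:R * al + t)).
have /andP[b3 b4] := sawtooth_primitive_itv al01 (fracpart_itv t).
rewrite alV in b1 b3.
set P := sawtooth_primitive _ _ in b1 b2 *; set Q := sawtooth_primitive _ _ in b3 b4 *.
have {b1 b2 b3 b4} PQ : `|P - Q| <= a%:R / 8 + 1 / 2.
  by rewrite ler_norml; apply/andP; split; lra.
clearbody P Q.
case: w fE => [_|m fE].
  (* No crossing: the new sum is empty and its offset is arbitrary. *)
  exists 0, 0%N; split; first by apply: mulr_ge0 => //; lra.
  by rewrite big_geq// addr0 /sawtooth_sum big_geq// normr0; lra.
set tau := t - _ - 1.
have stepE i : sawtooth ((tau - i%:R) / al) = sawtooth (tau / al - i%:R * al').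
  rewrite mulrBl alV -[in RHS](sawtoothD_int _ (- (i%:Z * a%:Z))) rmorphN/= intrM.
  by congr sawtooth; rewrite -[i%:~R]/(i%:R) -[a%:~R]/(a%:R); ring.
exists (tau / al - m%:R * al' + al'), m; split.
  have := floor_le (n%:R * al + t); have := floorD1_gt t.
  by rewrite fE !intrD -[m.+1%:~R]/(m.+1%:R) -natr1; lra.
rewrite big_nat_recr//= addrA (le_trans (ler_normD _ _))//.
have := normr_sawtooth ((tau - m%:R) / al).
suff -> : \sum_(0 <= i < m) sawtooth ((tau - i%:R) / al) =
          sawtooth_sum al' (tau / al - m%:R * al' + al') m.
  set S := sawtooth_sum _ _ _; have := ler_normD (P - Q) S; lra.
rewrite big_nat_rev/= /sawtooth_sum; apply: eq_big_nat => i /andP[_ im].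
by rewrite stepE add0n natrB// -natr1; congr sawtooth; ring.
Qed.

Lemma sawtooth_sum_bound {R : realType} (a : nat -> nat) (x : nat -> R) :
  (forall h, (0 < h)%N -> 0 < x h < 1) ->
  (forall h, (0 < h)%N -> (x h)^-1 = (a h)%:R + x h.+1) ->
  forall K h t n, (0 < h)%N -> n%:R * \prod_(h <= i < h + K) x i < 1 ->
  `|sawtooth_sum (x h) t n| <= \sum_(h <= m < h + K) (1 + (a m)%:R / 8).
Proof.
move=> x01 xV; elim=> [|K IH] h t n h0.
  rewrite addn0 !big_geq// mulr1 ltrn1 ltnS leqn0 => /eqP->.
  by rewrite /sawtooth_sum big_geq// normr0.
have hK : (h < h + K.+1)%N by lia.
rewrite big_ltn// [leRHS]big_ltn// -addSnnS => nP.
have [t' [m [mn le_m]]] := sawtooth_sum_step t n (x01 h h0) (x01 h.+1 isT) (xV h h0).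
rewrite (le_trans le_m)// addrC lerD2l; apply: IH => //.
apply: le_lt_trans nP; rewrite mulrA ler_wpM2r//.
rewrite big_nat_cond prodr_ge0// => i /andP[/andP[hi _] _].
by have /andP[/ltW] := x01 i (ltn_trans h0 hi).
Qed.

(** * Complete quotients of a continued fraction *)

(** The denominators obey a recurrence at the far end of the expansion and the
complete quotients one at the near end; the factor
[q_K + x_{K+1} q_{K-1}] is what passes from one to the other when
[(x K)^-1 = a K + x K.+1] is substituted. *)
Lemma prod_complete_quotients {R : realType} (a : nat -> nat) (x : nat -> R) :
  (forall h, (0 < h)%N -> 0 < x h < 1) ->
  (forall h, (0 < h)%N -> (x h)^-1 = (a h)%:R + x h.+1) ->
  forall K, \prod_(1 <= i < K.+2) x i *
    ((cf_denom a K.+1)%:R + x K.+2 * (cf_denom a K)%:R) = 1.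
Proof.
move=> x01 xV K.
have xn0 h : (0 < h)%N -> x h != 0 by move=> /x01 /andP[/gt_eqF->].
elim: K => [|K IH].
  by rewrite big_nat1 /= mulr1 -xV// mulfV// xn0.
rewrite big_nat_recr//= -[RHS]IH -mulrA; congr (_ * _).
have aE : (a K.+2)%:R = (x K.+2)^-1 - x K.+3 by rewrite xV// addrK.
rewrite -/(cf_denom a K.+1) natrD natrM aE.
set q1 := (cf_denom a K.+1)%:R; set q0 := (cf_denom a K)%:R.
by field; rewrite xn0.
Qed.

Lemma cfrac_itv {R : realType} (a : nat -> nat) :
  (forall h, (0 < h)%N -> (0 < a h)%N) ->
  forall n h, (0 < h)%N -> 0 <= cfrac R a h n <= 1.
Proof.
move=> a_gt0; elim=> [|n IH] h h0 /=; first by rewrite lexx ler01.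
have /andP[c0 c1] := IH h.+1 isT.
have a1 : (1 : R) <= (a h)%:R by rewrite ler1n a_gt0.
by apply/andP; split; [rewrite invr_ge0 | rewrite invf_le1]; lra.
Qed.

Lemma irrational_itv {R : realType} (x : R) :
  irrational x -> 0 <= x <= 1 -> 0 < x < 1.
Proof.
move=> irr /andP[x0 x1]; rewrite !lt_neqAle x0 x1 !andbT.
apply/andP; split; apply/eqP => xE; apply: irr.
- by exists 0 => //; rewrite raddf0.
- by exists 1 => //; rewrite rmorph1.
Qed.

Lemma irrational_invB {R : realType} (x : R) (k : nat) :
  irrational x -> irrational (x^-1 - k%:R).
Proof.
move=> irr [q _ qE]; apply: irr; exists (q + k%:R)^-1 => //.
by rewrite fmorphV rmorphD/= qE ratr_nat subrK invrK.
Qed.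

(** Given as a limit instead of by the recurrence, so that the bounds
[0 <= x <= 1] are inherited from the finite continued fractions. *)
Definition complete_quotient {R : realType} (a : nat -> nat) (h : nat) : R :=
  limn (cfrac R a h).

Lemma cfrac_cvg_tail {R : realType} {a : nat -> nat} {h : nat} {l : R} :
  l != 0 -> cfrac R a h n @[n --> \oo] --> l ->
  cfrac R a h.+1 n @[n --> \oo] --> l^-1 - (a h)%:R.
Proof.
move=> l0 cvl.
have -> : cfrac R a h.+1 = fun n => (cfrac R a h n.+1)^-1 - (a h)%:R.
  by apply/funext => n /=; rewrite invrK addrAC subrr add0r.
apply: cvgB; last exact: cvg_cst.
apply: (@cvgV _ _ _ _ (fun n => cfrac R a h n.+1)) => //.
by rewrite (cvg_shiftS (cfrac R a h)).
Qed.

(** Irrationality is carried along because it is what keeps every complete quotient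
away from [0], where inversion is not continuous. *)
Lemma cfrac_cvg_irrational {R : realType} {a : nat -> nat} {alpha : R} :
  is_cfrac a alpha -> irrational alpha ->
  forall h, cfrac R a h.+1 n @[n --> \oo] --> (complete_quotient a h.+1 : R) /\
    irrational (complete_quotient a h.+1 : R).
Proof.
move=> [a_gt0 cva] irr; elim=> [|h [cvh irrh]].
  by rewrite /complete_quotient (cvg_lim _ cva).
have n0 : complete_quotient a h.+1 != 0 :> R.
  by apply/eqP => e; apply: irrh; exists 0 => //; rewrite raddf0 e.
have cvS := cfrac_cvg_tail n0 cvh.
have -> : complete_quotient a h.+2 = (complete_quotient a h.+1)^-1 - (a h.+1)%:R :> R.
  exact: cvg_lim.
by split=> //; exact: irrational_invB.
Qed.

Lemma complete_quotient_itv {R : realType} {a : nat -> nat} {alpha : R} :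
  is_cfrac a alpha -> irrational alpha ->
  forall h, (0 < h)%N -> 0 < (complete_quotient a h : R) < 1.
Proof.
move=> cfa irr [//|h] _; have [cvh irrh] := cfrac_cvg_irrational cfa irr h.
apply: irrational_itv => //; apply/andP; split.
- apply: (cvgr_to_ge cvh); apply: nearW => n.
  by have /andP[] := @cfrac_itv R _ cfa.1 n h.+1 isT.
- apply: (cvgr_to_le cvh); apply: nearW => n.
  by have /andP[] := @cfrac_itv R _ cfa.1 n h.+1 isT.
Qed.

Lemma complete_quotientV {R : realType} {a : nat -> nat} {alpha : R} :
  is_cfrac a alpha -> irrational alpha -> forall h, (0 < h)%N ->
  (complete_quotient a h)^-1 = (a h)%:R + complete_quotient a h.+1 :> R.
Proof.
move=> cfa irr [//|h] _; have [cvh _] := cfrac_cvg_irrational cfa irr h.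
have /andP[x0 _] := complete_quotient_itv cfa irr _ (ltn0Sn h).
have cvS := cfrac_cvg_tail (lt0r_neq0 x0) cvh.
by rewrite {2}/complete_quotient (cvg_lim _ cvS)// addrC subrK.
Qed.

(** * Orders of integers and denominators of convergents *)

#[local] Arguments cf_denom : simpl never.

Lemma cf_denomS (a : nat -> nat) h :
  cf_denom a h.+2 = (a h.+2 * cf_denom a h.+1 + cf_denom a h)%N.
Proof. by []. Qed.

Lemma cf_denom_gt0 (a : nat -> nat) h :
  (forall h, (0 < h)%N -> (0 < a h)%N) ->
  (0 < cf_denom a h)%N.
Proof.
move=> a_gt0; elim/ltn_ind: h => -[//|[|h]] IH; first exact: a_gt0.
by rewrite cf_denomS ltn_addl// IH.
Qed.

Lemma leq_cf_denom (a : nat -> nat) h :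
  (forall h, (0 < h)%N -> (0 < a h)%N) ->
  (h <= cf_denom a h)%N.
Proof.
move=> a_gt0; elim: h => [//|[|h] IH]; first exact: a_gt0.
rewrite cf_denomS -addn1 leq_add ?cf_denom_gt0//.
by rewrite (leq_trans IH)// leq_pmull ?a_gt0.
Qed.

(** If the leading digit is maximal then the next one vanishes, and what is below it
is less than [q_{N-1}], in accordance with [q_{N+1} = a_{N+1} q_N + q_{N-1}];
otherwise the lower digits contribute less than one further [q_N]. *)
Lemma ostrowski_lt (a : nat -> nat) c N :
  (forall h, (0 < h)%N -> (0 < a h)%N) ->
  (forall h, (h <= N)%N -> (c h <= a h.+1)%N) -> (c 0 <= a 1 - 1)%N ->
  (forall h, (0 < h <= N)%N -> c h = a h.+1 -> c h.-1 = 0%N) ->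
  (\sum_(0 <= h < N.+1) c h * cf_denom a h < cf_denom a N.+1)%N.
Proof.
move=> a_gt0 c_le c0 cc.
elim/ltn_ind: N c_le cc => -[|N] IH c_le cc.
  rewrite big_nat1 muln1 (leq_ltn_trans c0)//.
  have -> : cf_denom a 1 = a 1%N by [].
  by rewrite subn1 ltn_predL a_gt0.
rewrite big_nat_recr//= cf_denomS.
have [cE|cN] := eqVneq (c N.+1) (a N.+2).
  rewrite cE addnC ltn_add2l big_nat_recr//= (cc N.+1 _ cE) ?leqnn//= addn0.
  case: N IH c_le cc {cE} => [|N] IH c_le cc; first by rewrite big_geq.
  by apply: IH => // h hN; [apply: c_le|apply: cc]; lia.
have lt_c : (c N.+1 < a N.+2)%N by rewrite ltn_neqAle cN c_le.
have IHN : (\sum_(0 <= h < N.+1) c h * cf_denom a h < cf_denom a N.+1)%N.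
  by apply: IH => // h hN; [apply: c_le|apply: cc]; lia.
have : (c N.+1 * cf_denom a N.+1 + cf_denom a N.+1 <= a N.+2 * cf_denom a N.+1)%N.
  by rewrite -mulSnr leq_mul2r lt_c orbT.
lia.
Qed.

(** The greedy expansion. The value of the leading digit is part of the statement
for the induction: when the digit above is maximal, the remainder is less than
[q_{N-1}], which forces the greedy digit there to be [0]. *)
Lemma ostrowski_digits (a : nat -> nat) N r :
  (forall h, (0 < h)%N -> (0 < a h)%N) ->
  (r < cf_denom a N.+1)%N -> exists c,
  [/\ r = (\sum_(0 <= h < N.+1) c h * cf_denom a h)%N,
      forall h, (h <= N)%N -> (c h <= a h.+1)%N,
      (c 0 <= a 1 - 1)%N,
      forall h, (0 < h <= N)%N -> c h = a h.+1 -> c h.-1 = 0%N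
    & c N = (r %/ cf_denom a N)%N].
Proof.
move=> a_gt0; elim: N r => [|N IH] r rq.
  have {}rq : (r < a 1)%N := rq.
  exists (fun=> r); split => //.
  - by rewrite big_nat1 muln1.
  - by move=> h; rewrite leqn0 => /eqP->; exact: ltnW.
  - by lia.
  - by case.
  - by rewrite divn1.
have [c [rE c_le c0 cc cN]] := IH (r %% cf_denom a N.+1)%N
  (ltn_pmod _ (cf_denom_gt0 a _ a_gt0)).
pose c' h := if h == N.+1 then (r %/ cf_denom a N.+1)%N else c h.
have c'E h : (h <= N)%N -> c' h = c h by rewrite /c'; case: eqP => // ->; lia.
have c'N : c' N.+1 = (r %/ cf_denom a N.+1)%N by rewrite /c' eqxx.
have q0 h := cf_denom_gt0 a h a_gt0.
have mono : (cf_denom a N <= cf_denom a N.+1)%N.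
  case: (N) => [|N']; first exact: (q0 1).
  by rewrite cf_denomS (leq_trans _ (leq_addr _ _))// leq_pmull ?a_gt0.
exists c'; split => //.
- rewrite big_nat_recr//= c'N {1}(divn_eq r (cf_denom a N.+1)) addnC rE; congr addn.
  by apply: eq_big_nat => h /andP[_ hN]; rewrite c'E.
- move=> h; rewrite leq_eqVlt ltnS => /orP[/eqP->|hN]; last by rewrite c'E ?c_le.
  by rewrite c'N -ltnS ltn_divLR// (leq_trans rq)// cf_denomS mulSn addnC leq_add2r.
- move=> h /andP[h0]; rewrite leq_eqVlt ltnS => /orP[/eqP->|hN]; last first.
    by rewrite !c'E ?(leq_trans (leq_pred _))// => /cc; apply; rewrite h0.
  rewrite c'N c'E//= cN => cE; apply: divn_small.
  have := divn_eq r (cf_denom a N.+1); rewrite cE => rE'.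
  by rewrite rE' cf_denomS ltn_add2l in rq.
Qed.

(** [ostrowski_ord] chooses some order for which a representation exists. The greedy
expansion shows that there is one, and [ostrowski_lt] applies to whichever is
chosen. *)
Lemma ostrowski_ord_lt (a : nat -> nat) r :
  (forall h, (0 < h)%N -> (0 < a h)%N) ->
  (0 < r)%N -> (r < cf_denom a (ostrowski_ord a r).+1)%N.
Proof.
move=> a_gt0 r0; rewrite /ostrowski_ord.
suff : exists N, [set N | exists c, is_ostrowski a r N c] N.
  move=> /(xgetPex 0%N) [c [rE c_le c0 cc _]].
  by rewrite [X in (X < _)%N]rE ostrowski_lt.
have exN : exists N, (r < cf_denom a N.+1)%N by exists r; exact: leq_cf_denom.
case: (ex_minnP exN) => N rN minN; exists N.
have [c [rE c_le c0 cc cN]] := ostrowski_digits a _ _ a_gt0 rN.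
exists c; split=> //; rewrite cN divn_gt0 ?cf_denom_gt0//.
case: N minN {rN rE c_le cc cN} => [//|N] minN.
by rewrite leqNgt; apply/negP => /minN; rewrite ltnn.
Qed.

(** * Discrepancies as differences of sawtooth sums *)

Lemma fracpart_fracpartB {R : realType} (y d : R) :
  fracpart (fracpart y - d) = fracpart (y - d).
Proof.
rewrite -[RHS](fracpartD_int _ (- Num.floor y)) rmorphN/=; congr fracpart.
by rewrite /fracpart; ring.
Qed.

(** For [d = 1] the condition [u < d] always holds and [u - 1] lies in [[-1, 0[], so
the formula still holds; this covers intervals that reach the end of the circle. *)
Lemma fracpart_itvB {R : realType} (u d : R) : 0 <= u < 1 -> 0 <= d <= 1 ->
  fracpart (u - d) = u - d + (u < d)%R%:R.
Proof.
move=> /andP[u0 u1] /andP[d0 d1]; have [ltud|leud] := ltP u d.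
  by rewrite (@fracpart_unique _ _ (-1)) mulrN1z ?opprK; [rewrite /=; ring|apply/andP; split; lra].
by rewrite (@fracpart_unique _ _ 0) ?subr0 ?addr0//; apply/andP; split; lra.
Qed.

Lemma sawtoothB_indic {R : realType} (y g d : R) : 0 <= g <= 1 -> 0 <= d <= 1 ->
  sawtooth (y - d) - sawtooth (y - g) =
  ((fracpart y < d)%R%:R - (fracpart y < g)%R%:R) - (d - g).
Proof.
move=> g01 d01; have y01 := fracpart_itv y.
rewrite /sawtooth -[in LHS]fracpart_fracpartB -[fracpart (y - g)]fracpart_fracpartB.
by rewrite !fracpart_itvB//; ring.
Qed.

(** The half-open interval [[g, d[] is the one for which the sawtooth formula is
exact; the other types are compared with it pointwise. *)
Lemma indic_itv_error {R : realType} (bl br : bool) (u g d : R) : g <= d ->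
  `|\1_([set` Interval (BSide bl g) (BSide br d)]) u
     - ((u < d)%R%:R - (u < g)%R%:R) : R| <=
  (~~ bl && (u == g))%:R + (~~ br && (u == d))%:R.
Proof.
move=> gd; rewrite indicE mem_setE.
case: bl; case: br; rewrite in_itv/=; case: (ltgtP u g) => ug; case: (ltgtP u d) => ud;
  rewrite /= ?subr0 ?sub0r ?subrr ?normr0 ?normrN ?normr1 ?add0r ?addr0 ?normr0
    ?ler01 ?lexx//; try lra.
Qed.

Lemma discr_sawtooth_sum {R : realType} (n : nat) (alpha s : R) :
  discr n alpha (fracpart s) = sawtooth_sum alpha (- s) n - sawtooth_sum alpha 0 n.
Proof.
have /andP[s0 s1] := fracpart_itv s.
have cE : fracpart s * n%:R = \sum_(0 <= r < n) fracpart s.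
  by rewrite sumr_const_nat subn0 mulr_natr.
rewrite /discr cE /sawtooth_sum -!sumrB; apply: eq_big_nat => k _.
have /andP[f0 _] := fracpart_itv (k%:R * alpha).
have -> : sawtooth (k%:R * alpha - s) = sawtooth (k%:R * alpha - fracpart s).
  rewrite -[RHS](sawtoothD_int _ (- Num.floor s)) rmorphN/= /fracpart.
  by congr sawtooth; ring.
have := @sawtoothB_indic R (k%:R * alpha) 0 (fracpart s).
rewrite subr0 addr0 => ->; rewrite ?lexx ?ler01 ?s0 ?ltW//.
rewrite indicE mem_setE in_itv/= f0 /= [_ < 0]ltNge f0 /=.
by ring.
Qed.

Lemma itv_discr_sawtooth_sum {R : realType} (n : nat) (alpha beta : R) (bl br : bool)
    (g d : R) : 0 <= g <= 1 -> 0 <= d <= 1 ->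
  itv_discr n alpha beta bl br g d =
    sawtooth_sum alpha (beta - d) n - sawtooth_sum alpha (beta - g) n +
    \sum_(0 <= k < n)
      (\1_([set` Interval (BSide bl g) (BSide br d)]) (fracpart (k%:R * alpha + beta))
       - ((fracpart (k%:R * alpha + beta) < d)%R%:R
          - (fracpart (k%:R * alpha + beta) < g)%R%:R)).
Proof.
move=> g01 d01.
have cE : n%:R * (d - g) = \sum_(0 <= r < n) (d - g).
  by rewrite sumr_const_nat subn0 mulr_natl.
rewrite /itv_discr cE /sawtooth_sum -!sumrB -big_split/=; apply: eq_big_nat => k _.
by rewrite !addrA sawtoothB_indic//; ring.
Qed.

Lemma sum_unique_le1 {R : realType} (P : pred nat) n :
  (forall i j, P i -> P j -> i = j) -> \sum_(0 <= k < n) (P k)%:R <= 1 :> R.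
Proof.
move=> uniqP; elim: n => [|n IH]; first by rewrite big_geq.
rewrite big_nat_recr//=; case Pn: (P n); last by rewrite addr0.
rewrite big_nat_cond big1 ?add0r// => i /andP[/andP[_ i_n] _].
case Pi: (P i) => //; have e := uniqP _ _ Pi Pn; by rewrite e ltnn in i_n.
Qed.

Lemma irrational_nat_mul {R : realType} (x : R) (i j : nat) (m : int) :
  irrational x -> i%:R * x = j%:R * x + m%:~R -> i = j.
Proof.
move=> irr e; apply/eqP/negPn/negP => ij; apply: irr.
exists (m%:~R / (i%:R - j%:R)) => //.
have ijn0 : (i%:R - j%:R : R) != 0 by rewrite subr_eq0 eqr_nat.
rewrite fmorph_div rmorphB/= !ratr_nat ratr_int.
by apply: (mulIf ijn0); rewrite divfK//; lra.
Qed.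

(** Hence the orbit visits each endpoint of an interval at most once. *)
Lemma fracpart_orbit_inj {R : realType} (alpha beta : R) i j :
  irrational alpha -> fracpart (i%:R * alpha + beta) = fracpart (j%:R * alpha + beta) ->
  i = j.
Proof.
move=> irr e.
apply: (@irrational_nat_mul _ alpha _ _ (Num.floor (i%:R * alpha + beta) -
   Num.floor (j%:R * alpha + beta)) irr).
by move: e; rewrite /fracpart rmorphB/=; lra.
Qed.

Lemma itv_discr_endpoint_error {R : realType} (n : nat) (alpha beta : R)
    (bl br : bool) (g d : R) : irrational alpha -> 0 <= g -> g <= d -> d <= 1 ->
  `|itv_discr n alpha beta bl br g d
     - (sawtooth_sum alpha (beta - d) n - sawtooth_sum alpha (beta - g) n)| <= 2.
Proof.
move=> irr g0 gd d1.
rewrite itv_discr_sawtooth_sum; [|apply/andP; split; lra..].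
rewrite addrC addKr (le_trans (ler_norm_sum _ _ _))//.
have hit v : \sum_(0 <= k < n) (fracpart (k%:R * alpha + beta) == v)%:R <= 1 :> R.
  apply: sum_unique_le1 => i j /eqP ei /eqP ej.
  by apply: (@fracpart_orbit_inj _ alpha beta _ _ irr); rewrite ei ej.
have := lerD (hit g) (hit d); rewrite -big_split/= => h2.
apply: le_trans h2; apply: ler_sum => k _.
rewrite (le_trans (indic_itv_error _ _ _ _ _ gd))// lerD//.
- by case: bl => /=; rewrite ?ler0n.
- by case: br => /=; rewrite ?ler0n.
Qed.

Theorem theorem4p6 (R : realType) (a : nat -> nat) (alpha beta : R)
    (cf_alpha : is_cfrac a alpha)
    (alpha01 : 0 < alpha < 1)
    (alpha_irr : irrational alpha)
    (beta01 : 0 <= beta < 1)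
    (bl br : bool) (gamma delta : R)
    (gamma_ge0 : 0 <= gamma) (gamma_le_delta : gamma <= delta)
    (delta_le1 : delta <= 1)
    (n : nat) :
  ((forall k, (k < n)%N -> bl = false -> fracpart (k%:R * alpha + beta) <> gamma) ->
   (forall k, (k < n)%N -> br = false -> fracpart (k%:R * alpha + beta) <> delta) ->
   itv_discr n alpha beta bl br gamma delta =
     discr n alpha (fracpart (delta - beta)) - discr n alpha (fracpart (gamma - beta)))
  /\
  ((1 < n)%N ->
   `|itv_discr n alpha beta bl br gamma delta| <=
     2 * \sum_(1 <= m < (ostrowski_ord a n.-1).+2) (3 + (a m)%:R / 4)).
Proof.
have g01 : 0 <= gamma <= 1 by apply/andP; split; lra.
have d01 : 0 <= delta <= 1 by apply/andP; split; lra.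
split=> [no_l no_r|n1].
  rewrite !discr_sawtooth_sum itv_discr_sawtooth_sum// !opprB big_nat_cond big1 ?addr0.
    by ring.
  move=> k /andP[/andP[_ kn] _]; apply/eqP; rewrite -normr_le0.
  rewrite (le_trans (indic_itv_error _ _ _ _ _ gamma_le_delta))//.
  have /negP/negbTE-> : ~ (~~ bl && (fracpart (k%:R * alpha + beta) == gamma)).
    by move=> /andP[/negbTE bl0 /eqP]; exact: no_l.
  have /negP/negbTE-> : ~ (~~ br && (fracpart (k%:R * alpha + beta) == delta)).
    by move=> /andP[/negbTE br0 /eqP]; exact: no_r.
  by rewrite addr0.
set N := ostrowski_ord a n.-1.
have nq : (n <= cf_denom a N.+1)%N.
  have := ostrowski_ord_lt a n.-1 cf_alpha.1 ltac:(lia); rewrite -/N; lia.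
pose x := @complete_quotient R a.
have x01 := complete_quotient_itv cf_alpha alpha_irr : forall h, (0 < h)%N -> 0 < x h < 1.
have xV := complete_quotientV cf_alpha alpha_irr :
  forall h, (0 < h)%N -> (x h)^-1 = (a h)%:R + x h.+1.
have x1 : x 1%N = alpha by rewrite /x /complete_quotient (cvg_lim _ cf_alpha.2).
have nP : n%:R * \prod_(1 <= i < 1 + N.+1) x i < 1.
  have P0 : 0 < \prod_(1 <= i < 1 + N.+1) x i.
    rewrite big_nat_cond prodr_gt0// => i /andP[/andP[i1 _] _].
    by have /andP[] := x01 i i1.
  rewrite -[ltRHS](prod_complete_quotients a x x01 xV N) [ltLHS]mulrC ltr_pM2l//.
  have n_le : (n%:R : R) <= (cf_denom a N.+1)%:R by rewrite ler_nat.
  have /andP[x0 _] := x01 N.+2 isT.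
  have q0 : 0 < (cf_denom a N)%:R :> R by rewrite ltr0n cf_denom_gt0//; exact: cf_alpha.1.
  have := mulr_gt0 x0 q0; lra.
have Sle t : `|sawtooth_sum alpha t n| <= \sum_(1 <= m < N.+2) (1 + (a m)%:R / 8).
  by have := sawtooth_sum_bound a x x01 xV N.+1 1%N t n isT nP; rewrite x1.
have err := @itv_discr_endpoint_error _ n alpha beta bl br _ _ alpha_irr gamma_ge0
  gamma_le_delta delta_le1.
have S1 := Sle (beta - delta); have S2 := Sle (beta - gamma).
have : \sum_(1 <= m < N.+2) (1 + (a m)%:R / 8) + 1 <=
       \sum_(1 <= m < N.+2) (3 + (a m)%:R / 4) :> R.
  rewrite big_ltn// [leRHS]big_ltn//.
  have : \sum_(2 <= m < N.+2) (1 + (a m)%:R / 8) <=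
         \sum_(2 <= m < N.+2) (3 + (a m)%:R / 4) :> R.
    by apply: ler_sum => m _; have := ler0n R (a m); lra.
  have := ler0n R (a 1%N); lra.
move: S1 S2 err; rewrite !ler_norml => /andP[? ?] /andP[? ?] /andP[? ?] ?.
by apply/andP; split; lra.
Qed.
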